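(* Let $\phi$ be an admissible potential with equilibrium state $\mu_\phi$, and let $C>0$ be a constant for which the Gaussian concentration bound holds for $\mu_\phi$. Then for every Borel subset $B\subset\Omega$ with $\mu_\phi(B)>0$, every $n\ge1$ and every $u>0$, $$\mu_\phi\Big\{x\in\Omega:\ \mathcal{S}_B(x,n)\ge\frac{u_B+u}{\sqrt n}\Big\}\le e^{-\frac{u^2}{4C}},\qquad\text{where}\quad u_B=2\sqrt{-C\ln\mu_\phi(B)}$$ and $\mathcal{S}_B(x,n)=\frac1n\inf_{y\in B}\sum_{j=0}^{n-1}d_\theta(T^jx,T^jy)$.
   Context: $A$ is a finite alphabet, $\mathbb{N}=\{0,1,2,\dots\}$, $\Omega=A^{\mathbb{N}}$ with points $x=x^0x^1x^2\cdots$, and $T:\Omega\to\Omega$ is the shift $(Tx)^k=x^{k+1}$. Fix $\theta\in(0,1)$ and put $d_\theta(x,y)=\theta^{\inf\{k:\,x^k\ne y^k\}}$ (with $d_\theta(x,x)=0$). For $\phi:\Omega\to\mathbb{R}$ write $S_n\phi=\sum_{i=0}^{n-1}\phi\circ T^i$. For $x,y\in\Omega$ let $W(\phi,x,y)=\sup_{n\in\mathbb{N}}\sup_{a\in A^n}|S_n\phi(ax)-S_n\phi(ay)|$, and for $p\in\mathbb{N}$ let $W_p(\phi)=\sup\{W(\phi,x,y): x^i=y^i,\ 0\le i\le p-1\}$. A continuous $\phi$ satisfies Walters' condition if $\sup_{x,y}W(\phi,x,y)<\infty$ and $(W_p(\phi))_{p\in\mathbb{N}}$ is strictly positive and decreases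 to $0$. Such a $\phi$ has a unique equilibrium state $\mu_\phi$ (the unique shift-invariant probability measure maximizing $\nu\mapsto h(\nu)+\int\phi\,d\nu$, $h$ being the entropy). ''Admissible'' means: $\phi$ is continuous, satisfies Walters' condition, and one of: (1) $W_n(\phi)=O(\theta^n)$; (2) $W_n(\phi)=O(n^{-\alpha})$ for some $\alpha>1$; (3) $W_n(\phi)=O(\eta^{(\log n)^{\alpha}})$ for some $\eta\in(0,1)$, $\alpha>1$; (4) $W_n(\phi)=O(e^{-cn^{\alpha}})$ for some $c>0$, $\alpha\in(0,1)$. A function $K:\Omega^n\to\mathbb{R}$ is separately $d_\theta$-Lipschitz if for every $i\in\{0,\dots,n-1\}$ there is a constant $\mathrm{Lip}_{\theta,i}(K)$ (taken to be the smallest one) such that $|K(x_0,\dots,x_i,\dots,x_{n-1})-K(x_0,\dots,x_i',\dots,x_{n-1})|\le \mathrm{Lip}_{\theta,i}(K)\,d_\theta(x_i,x_i')$ for all points of $\Omega$. The Gaussian concentration bound with constant $C$: for all $n\ge1$ and all separately $d_\theta$-Lipschitz $K:\Omega^n\to\mathbb{R}$, $\int e^{K(x,\dots,T^{n-1}x)}d\mu_\phi(x)\le \exp\big(\int K(x,\dots,T^{n-1}x)\,d\mu_\phi(x)\big)\exp\big(C\sum_{j=0}^{n-1}\mathrm{Lip}_{\theta,j}(K)^2\big)$. For admissible $\phi$ such a constant $C>0$ exists (main theorem of the paper). *)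

(* Defs.v *)
From HB Require Import structures.
From mathcomp Require Import all_boot all_order all_algebra.
From mathcomp Require Import all_classical all_reals all_analysis.

Set Implicit Arguments.
Unset Strict Implicit.
Unset Printing Implicit Defensive.

Import Order.TTheory GRing.Theory Num.Theory.
Import numFieldNormedType.Exports.

Local Open Scope classical_set_scope.
Local Open Scope ring_scope.

(* [pointedType] (a nonempty alphabet) because the library's measurable types
   are pointed; finiteness of the alphabet is a hypothesis where it matters. *)
Definition fullshift (A : pointedType) : Type :=
  prod_topology (fun _ : nat => discrete_topology A).

HB.instance Definition _ (A : pointedType) := Pointed.on (fullshift A).
HB.instance Definition _ (A : pointedType) := Nbhs.on (fullshift A).
HB.instance Definition _ (A : pointedType) := Topological.on (fullshift A).
HB.instance Definition _ (A : pointedType) :=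
  Measurable.copy (fullshift A) (g_sigma_algebraType (@open (fullshift A))).

Definition left_shift (A : pointedType) (x : fullshift A) : fullshift A :=
  fun k => x k.+1.

Definition prepend (A : pointedType) (n : nat) (a : n.-tuple A)
    (x : fullshift A) : fullshift A :=
  fun k => nth (x (k - n)%N) a k.

Definition dtheta (R : realType) (A : pointedType) (theta : R)
    (x y : fullshift A) : R :=
  match pselect (exists k, (x k : A) != y k) with
  | left xy => theta ^+ ex_minn xy
  | right _ => 0
  end.

Section potential.
Context (R : realType) (A : pointedType).
Implicit Types (phi : fullshift A -> R) (x y : fullshift A).

Definition birkhoff phi (n : nat) x : R := \sum_(i < n) phi (iter i (@left_shift A) x).

Local Open Scope ereal_scope.

Definition walters_W phi x y : \bar R :=
  ereal_sup [set l | exists (n : nat) (a : n.-tuple A),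
    l = (`|birkhoff phi n (prepend a x) - birkhoff phi n (prepend a y)|%R)%:E].

Definition walters_Wp phi (p : nat) : \bar R :=
  ereal_sup [set l | exists x y,
    (forall i, (i < p)%N -> x i = y i) /\ l = walters_W phi x y].

Definition walters_condition phi : Prop :=
  [/\ ereal_sup [set l | exists x y, l = walters_W phi x y] < +oo,
      forall p, 0 < walters_Wp phi p,
      nonincreasing_seq (walters_Wp phi) &
      walters_Wp phi @ \oo --> 0].

(* The values of [walters_Wp] are finite under Walters' condition, so [fine]
   loses nothing below. The values of the rates at n = 0 are irrelevant to
   a big O at infinity. *)
Definition admissible (theta : R) phi : Prop :=
  let W n := fine (walters_Wp phi n) in
  [/\ continuous phi, walters_condition phi &
   [\/ W =O_\oo (fun n : nat => theta ^+ n)%R,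
       exists alpha : R, (1 < alpha)%R /\
         W =O_\oo (fun n : nat => n%:R `^ (- alpha))%R,
       exists eta alpha : R, [/\ (0 < eta < 1)%R, (1 < alpha)%R &
         W =O_\oo (fun n : nat => eta `^ (ln n%:R `^ alpha))%R] |
       exists c alpha : R, [/\ (0 < c)%R, (0 < alpha < 1)%R &
         W =O_\oo (fun n : nat => expR (- c * n%:R `^ alpha))%R]]].

End potential.

Section entropy.
Context (R : realType) (A : pointedType).
Implicit Types nu : probability (fullshift A) R.

Definition shift_invariant nu : Prop :=
  forall B : set (fullshift A), measurable B -> nu (@left_shift A @^-1` B) = nu B.

(* A finite measurable partition with k labelled (possibly empty) atoms is
   given by its labelling function xi. *)
Definition measurable_partition (k : nat) (xi : fullshift A -> 'I_k) : Prop :=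
  forall i : 'I_k, measurable (xi @^-1` [set i]).

(* Shannon entropy of the join of the xi \o T^i, i < n; [ln 0 = 0] yields the
   convention 0 ln 0 = 0. *)
Definition join_entropy nu (k : nat) (xi : fullshift A -> 'I_k) (n : nat) : R :=
  - \sum_(w : n.-tuple 'I_k)
      let p := fine (nu [set x | forall i : 'I_n,
                           xi (iter i (@left_shift A) x) = tnth w i]) in
      p * ln p.

Definition partition_entropy nu (k : nat) (xi : fullshift A -> 'I_k) : R :=
  limn (fun n : nat => join_entropy nu xi n / n%:R).

Definition entropy nu : \bar R :=
  ereal_sup [set l | exists (k : nat) (xi : fullshift A -> 'I_k),
    measurable_partition xi /\ l = (partition_entropy nu xi)%:E].

Definition pressure (phi : fullshift A -> R) nu : \bar R :=
  (entropy nu + \int[nu]_x (phi x)%:E)%E.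

Definition equilibrium_state (phi : fullshift A -> R) nu : Prop :=
  shift_invariant nu /\
  forall nu' : probability (fullshift A) R, shift_invariant nu' ->
    (pressure phi nu' <= pressure phi nu)%E.

End entropy.

Section concentration.
Context (R : realType) (A : pointedType).

(* [0 <= L] only matters for a one-letter alphabet: it keeps the infimum in
   [Lip] well defined there. *)
Definition lip_const (theta : R) (n : nat) (K : ('I_n -> fullshift A) -> R)
    (i : 'I_n) (L : R) : Prop :=
  0 <= L /\ forall z z' : 'I_n -> fullshift A,
    (forall j, j != i -> z j = z' j) ->
    `|K z - K z'| <= L * dtheta theta (z i) (z' i).

Definition separately_lipschitz (theta : R) (n : nat)
    (K : ('I_n -> fullshift A) -> R) : Prop :=
  forall i, exists L, lip_const theta K i L.

Definition Lip (theta : R) (n : nat) (K : ('I_n -> fullshift A) -> R)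
    (i : 'I_n) : R :=
  inf [set L | lip_const theta K i L].

Definition orbit_segment (n : nat) (x : fullshift A) : 'I_n -> fullshift A :=
  fun j => iter j (@left_shift A) x.
Arguments orbit_segment n x : clear implicits.

Definition gaussian_concentration (theta : R) (mu : probability (fullshift A) R)
    (C : R) : Prop :=
  forall (n : nat) (K : ('I_n -> fullshift A) -> R), (1 <= n)%N ->
    separately_lipschitz theta K ->
    (\int[mu]_x (expR (K (orbit_segment n x)))%:E <=
     (expR (\int[mu]_x K (orbit_segment n x))%R *
      expR (C * \sum_(j < n) Lip theta K j ^+ 2))%:E)%E.

Definition shadowing (theta : R) (B : set (fullshift A)) (x : fullshift A)
    (n : nat) : R :=
  n%:R^-1 * inf [set \sum_(j < n)
    dtheta theta (iter j (@left_shift A) x) (iter j (@left_shift A) y) | y in B].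

End concentration.

(* Main.v *)
(** The blockwise distance to [B], the infimum over [y] in [B] of
    [\sum_j dtheta (z j) (T^j y)], is separately 1-Lipschitz, so its values [F]
    along orbits satisfy [E(exp(t F)) <= exp(t E(F) + C n t^2)] for all real
    [t].  Negative [t] bounds [E(F)]: [F = 0] on [B], hence
    [mu B <= exp(- |t| E(F) + C n t^2)], and [|t| = E(F) / (2 C n)] gives
    [E(F) <= u_B * sqrt n].  Positive [t] gives the Chernoff bound for
    [F >= E(F) + u * sqrt n]. *)
Require Import Defs.
From mathcomp Require Import all_boot all_order all_algebra.
From mathcomp Require Import all_classical all_reals all_analysis.
From mathcomp Require Import measurable_realfun.
From mathcomp Require Import ring.
From HB Require Import structures.

Set Implicit Arguments.
Unset Strict Implicit.
Unset Printing Implicit Defensive.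

Import Order.TTheory GRing.Theory Num.Theory.
Import numFieldNormedType.Exports.

Local Open Scope classical_set_scope.
Local Open Scope ring_scope.

(** * Tail and mean bounds from a sub-Gaussian moment generating function *)

Section sub_gaussian.
Context d (T : measurableType d) (R : realType) (P : probability T R).
Variables (X : {RV P >-> R}) (m V : R).
Hypotheses (V_gt0 : 0 < V)
  (mgfX : forall t, ('M_P X t <= (expR (t * m + V * t ^+ 2))%:E)%E).

Lemma sub_gaussian_tail (r : R) : 0 < r ->
  (P [set x | (m + r <= X x)%R] <= (expR (- (r ^+ 2 / (4 * V))))%:E)%E.
Proof.
(* After Chernoff the terms in [m] cancel; this [t] minimises the remaining exponent
   [V * t ^+ 2 - t * r]. *)
move=> r_gt0; pose t := r / (2 * V).
have t_gt0 : 0 < t by rewrite divr_gt0// mulr_gt0.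
apply: (le_trans (chernoff X (m + r) t_gt0)).
apply: (le_trans (lee_wpmul2r _ (mgfX t))); first by rewrite lee_fin expR_ge0.
rewrite -EFinM lee_fin -expRD ler_expR le_eqVlt; apply/orP; left; apply/eqP.
by rewrite /t; field; rewrite gt_eqF.
Qed.

(** [exp(t X)] is 1 on [B] and nonnegative elsewhere, so its mean is at least [P B] for every [t];
    the best choice of [t] bounds [m]. *)
Lemma sub_gaussian_mean_le (B : set T) : measurable B -> (0 < P B)%E ->
  (forall x, B x -> X x = 0) ->
  m <= 2 * Num.sqrt (- (V * ln (fine (P B)))).
Proof.
move=> mB PB_gt0 XB0.
have PB_fin : P B \is a fin_num by exact: fin_num_measure.
have p_gt0 : 0 < fine (P B) by rewrite fine_gt0// PB_gt0 ltey_eq PB_fin.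
have [m_le0|m_gt0] := leP m 0.
  by rewrite (le_trans m_le0)// mulr_ge0// sqrtr_ge0.
have PB_le t : fine (P B) <= expR (t * m + V * t ^+ 2).
  rewrite -lee_fin fineK// (le_trans _ (mgfX t))// /mmt_gen_fun unlock.
  rewrite -(setIT B) -(integral_indic P measurableT mB).
  apply: ge0_le_integral => //=.
  - by apply/measurable_EFinP; exact: measurable_indic.
  - apply/measurable_EFinP; apply: measurableT_comp => //.
    exact: measurable_funM.
  - move=> x _; rewrite lee_fin indicE.
    case: (boolP (x \in B)) => [/set_mem Bx|_].
      by rewrite XB0// mul0r expR0.
    exact: expR_ge0.
(* The minimiser of [t * m + V * t ^+ 2], with minimum [- m ^+ 2 / (4 * V)]. *)
have := PB_le (- (m / (2 * V))).
rewrite -[X in X <= _ -> _]lnK ?posrE// ler_expR => lnp_le.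
have m2_le : (m / 2) ^+ 2 <= - (V * ln (fine (P B))).
  rewrite -mulrN -ler_pdivrMl// lerNr (le_trans lnp_le)//.
  rewrite le_eqVlt; apply/orP; left; apply/eqP.
  by field; rewrite gt_eqF.
rewrite mulrC -ler_pdivrMr// -[leLHS]ger0_norm ?divr_ge0 ?(ltW m_gt0)//.
by rewrite -sqrtr_sqr ler_wsqrtr.
Qed.

End sub_gaussian.

(** * The metric [dtheta] and the cylinders of the full shift *)

Section shift_metric.
Context (R : realType) (A : pointedType) (theta : R).
Hypothesis theta01 : 0 < theta < 1.
Implicit Types (x y z : fullshift A).

Let theta_ge0 : 0 <= theta. Proof. by case/andP: theta01 => /ltW. Qed.
Let theta_le1 : theta <= 1. Proof. by case/andP: theta01 => _ /ltW. Qed.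

Lemma dtheta_ge0 x y : 0 <= dtheta theta x y.
Proof. by rewrite /dtheta; case: pselect => // ?; exact: exprn_ge0. Qed.

Lemma dtheta_le_expn x y k : (forall i, (i < k)%N -> x i = y i) ->
  dtheta theta x y <= theta ^+ k.
Proof.
move=> xyk; rewrite /dtheta; case: pselect => [xy|_]; last exact: exprn_ge0.
case: ex_minnP => i xyi _; rewrite ler_wiXn2l// leqNgt; apply/negP => /xyk.
by apply/eqP.
Qed.

Lemma expn_le_dtheta x y k : (x k : A) != y k ->
  theta ^+ k <= dtheta theta x y.
Proof.
move=> xyk; rewrite /dtheta; case: pselect => [xy|[]]; last by exists k.
by case: ex_minnP => i _ /(_ _ xyk) ik; rewrite ler_wiXn2l.
Qed.

Lemma dthetaxx x : dtheta theta x x = 0.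
Proof.
rewrite /dtheta; case: pselect => [xx|//].
by case: ex_minnP => k; rewrite eqxx.
Qed.

Lemma dtheta_le_sym x y : dtheta theta x y <= dtheta theta y x.
Proof.
rewrite {1}/dtheta; case: pselect => [xy|_]; last exact: dtheta_ge0.
by case: ex_minnP => k xyk _; apply: expn_le_dtheta; rewrite eq_sym.
Qed.

Lemma dthetaC x y : dtheta theta x y = dtheta theta y x.
Proof. by apply/le_anti; rewrite !dtheta_le_sym. Qed.

(** At the first index where [x] and [z] differ, [y] differs from one of them, so a single summand
    on the right already suffices. *)
Lemma dtheta_triangle y x z :
  dtheta theta x z <= dtheta theta x y + dtheta theta y z.
Proof.
rewrite {1}/dtheta; case: pselect => [xz|_]; last first.
  by rewrite addr_ge0// dtheta_ge0.
case: ex_minnP => k xzk _; have [xyk|xyk] := eqVneq (x k : A) (y k).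
  rewrite xyk in xzk.
  by rewrite (le_trans (expn_le_dtheta xzk)) ?lerDr ?dtheta_ge0.
by rewrite (le_trans (expn_le_dtheta xyk)) ?lerDl ?dtheta_ge0.
Qed.

Lemma iter_left_shiftE j x k : iter j (@left_shift A) x k = x (j + k)%N.
Proof. by elim: j k => //= j IH k; rewrite /left_shift IH addnS. Qed.

(** A cylinder is a finite intersection of preimages of singletons, open in the discrete alphabet,
    under continuous projections. *)
Lemma nbhs_cylinder x N :
  nbhs x [set y : fullshift A | forall i, (i < N)%N -> x i = y i].
Proof.
elim: N => [|N IH]; first by apply: filterE => y i.
have xN : nbhs x [set y : fullshift A | x N = y N].
  pose projN := @proj _ (fun _ : nat => discrete_topology A) N.
  have xN : nbhs x (projN @^-1` [set x N]).
    exact: (@proj_continuous _ _ N x [set x N] (discrete_set1 _)).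
  rewrite (_ : [set y | _] = projN @^-1` [set x N]).
    exact: xN.
  by apply/seteqP; split=> y /esym.
apply: filterS2 IH xN => y /= xyN eqN i.
by rewrite ltnS leq_eqVlt => /predU1P[->|/xyN].
Qed.

End shift_metric.

(** Open rays generate the Borel sets of the line, and their preimages are open, hence generators of
    the sigma-algebra on [fullshift A]. *)
Lemma continuous_measurable_fullshift {R : realType} {A : pointedType}
  (f : fullshift A -> R) : continuous f -> measurable_fun setT f.
Proof.
move=> cf mT; apply: (measurability _ (RGenOInfty.measurableE R)) => //.
move=> _ [_ [a ->] <-]; rewrite setTI; apply: sub_sigma_algebra.
by apply: open_comp; [move=> x _; exact: cf | exact: interval_open].
Qed.

(** * Distance from a block of points to the orbit segments starting in [B] *)

Section block_distance.
Context (R : realType) (A : pointedType) (theta : R).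
Hypothesis theta01 : 0 < theta < 1.
Variables (B : set (fullshift A)) (n : nat).
Hypothesis B_neq0 : B !=set0.
Implicit Types z : 'I_n -> fullshift A.

(** Defined on arbitrary blocks, not only orbit segments, since the concentration bound varies each
    coordinate independently. *)
Definition block_dist z : R :=
  inf [set \sum_(j < n) dtheta theta (z j) (iter j (@left_shift A) y) | y in B].

Lemma block_dist_lbound0 z :
  lbound [set \sum_(j < n) dtheta theta (z j) (iter j (@left_shift A) y)
         | y in B] 0.
Proof. by move=> _ [y _ <-]; apply: sumr_ge0 => j _; exact: dtheta_ge0. Qed.

Lemma block_dist_ge0 z : 0 <= block_dist z.
Proof.
apply: lb_le_inf; last exact: block_dist_lbound0.
by have [y By] := B_neq0; eexists; exists y.
Qed.

Lemma block_dist_le z y : B y ->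
  block_dist z <= \sum_(j < n) dtheta theta (z j) (iter j (@left_shift A) y).
Proof.
move=> By; apply: ge_inf; last by exists y.
by exists 0; exact: block_dist_lbound0.
Qed.

Lemma block_dist_triangle z z' :
  block_dist z <= \sum_(j < n) dtheta theta (z j) (z' j) + block_dist z'.
Proof.
rewrite -lerBlDl; apply: lb_le_inf.
  by have [y By] := B_neq0; eexists; exists y.
move=> _ [y By <-]; rewrite lerBlDl (le_trans (block_dist_le z By))//.
by rewrite -big_split/=; apply: ler_sum => j _; exact: dtheta_triangle.
Qed.

Lemma block_dist_orbit_eq0 y : B y -> block_dist (@orbit_segment A n y) = 0.
Proof.
move=> By; apply/eqP; rewrite eq_le block_dist_ge0 andbT.
by rewrite (le_trans (block_dist_le _ By))// big1// => j _; rewrite dthetaxx.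
Qed.

Lemma block_dist_lipschitz z z' :
  `|block_dist z - block_dist z'| <= \sum_(j < n) dtheta theta (z j) (z' j).
Proof.
rewrite ler_norml lerNl opprB !lerBlDr block_dist_triangle andbT.
under eq_bigr do rewrite (dthetaC theta01).
exact: block_dist_triangle.
Qed.

(** When only coordinate [i] changes, one term of the bound in [block_dist_lipschitz] survives. The
    factor [t] stands on the right as in the exponent of [mmt_gen_fun]. *)
Lemma lip_const_block_dist (t : R) (i : 'I_n) :
  lip_const theta (fun z => block_dist z * t) i `|t|.
Proof.
split=> // z z' zz'; rewrite -mulrBl normrM mulrC ler_wpM2l//.
rewrite (le_trans (block_dist_lipschitz z z'))// (bigD1 i)//= big1 ?addr0//.
by move=> j /zz' ->; exact: dthetaxx.
Qed.

Lemma Lip_block_dist_sqr_le (t : R) (i : 'I_n) :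
  Lip theta (fun z => block_dist z * t) i ^+ 2 <= t ^+ 2.
Proof.
rewrite -[leRHS]real_normK ?num_real// lerXn2r ?nnegrE//.
- apply: lb_le_inf; last by move=> L [].
  by exists `|t|; exact: lip_const_block_dist.
- apply: ge_inf; last exact: lip_const_block_dist.
  by exists 0 => L [].
Qed.

Lemma block_dist_le_size z : block_dist z <= n%:R.
Proof.
have [y By] := B_neq0; rewrite (le_trans (block_dist_le z By))//.
rewrite -[X in X%:R](card_ord n) -sumr_const; apply: ler_sum => j _.
exact: (dtheta_le_expn theta01 (k := 0)).
Qed.

(** Gives measurability, which an infimum over a possibly uncountable [B] does not yield directly.
    If [x] and [y] agree on [n + N] coordinates, their first [n] shifts agree on [N], so the values
    differ by at most [n * theta ^+ N]. *)
Lemma continuous_block_dist_orbit :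
  continuous (fun x => block_dist (@orbit_segment A n x)).
Proof.
move=> x; apply/(@cvgrPdist_lt R R^o _ (nbhs x)) => e e_gt0.
have theta_cvg : (fun N => n%:R * theta ^+ N) @ \oo --> (0 : R).
  rewrite -[X in _ --> X](mulr0 (n%:R : R)); apply: cvgM; first exact: cvg_cst.
  apply: cvg_expr; case/andP: theta01 => t0 t1.
  by rewrite ger0_norm// ltW.
have [N _ /(_ _ (leqnn _)) /= Ne] : \forall N \near \oo, n%:R * theta ^+ N < e.
  exact: (cvgr_lt _ theta_cvg _ e_gt0).
apply: filterS (nbhs_cylinder x (n + N)) => y xy.
rewrite (le_lt_trans (block_dist_lipschitz _ _))// (le_lt_trans _ Ne)//.
rewrite mulr_natl -[X in _ *+ X](card_ord n) -sumr_const.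
apply: ler_sum => j _; apply: dtheta_le_expn => // i iN.
rewrite /orbit_segment !iter_left_shiftE; apply: xy.
by rewrite -addnS leq_add// ltnW.
Qed.

Lemma shadowing_block_dist x :
  shadowing theta B x n = n%:R^-1 * block_dist (@orbit_segment A n x).
Proof. by []. Qed.

End block_distance.

Theorem theorem3p11 (R : realType) (A : pointedType) (theta : R)
    (phi : fullshift A -> R) (mu : probability (fullshift A) R) (C : R)
    (finA : finite_set [set: A])
    (theta01 : 0 < theta < 1)
    (phi_adm : admissible theta phi)
    (mu_eq : equilibrium_state phi mu)
    (C_gt0 : 0 < C)
    (mu_gcb : gaussian_concentration theta mu C)
    (B : set (fullshift A)) (mB : measurable B) (B_gt0 : (0 < mu B)%E)
    (n : nat) (n_ge1 : (1 <= n)%N) (u : R) (u_gt0 : 0 < u) :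
  let u_B := 2 * Num.sqrt (- (C * ln (fine (mu B)))) in
  (mu [set x | ((u_B + u) / Num.sqrt n%:R <= shadowing theta B x n)%R]
     <= (expR (- (u ^+ 2 / (4 * C))))%:E)%E.
Proof.
cbv zeta; set u_B := 2 * Num.sqrt _.
have B_neq0 : B !=set0.
  by apply/set0P/eqP => B0; move: B_gt0; rewrite B0 measure0 ltxx.
pose F (x : fullshift A) := block_dist theta B (@orbit_segment A n x).
have mF : measurable_fun setT F.
  by apply: continuous_measurable_fullshift; exact: continuous_block_dist_orbit.
have intF : mu.-integrable setT (EFin \o F).
  apply: measurable_bounded_integrable => //; first exact: fin_num_fun_lty.
  exists n%:R; split => // M nM x _ /=.
  rewrite ger0_norm ?block_dist_ge0// ltW// (le_lt_trans _ nM)//.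
  exact: block_dist_le_size.
pose X : {RV mu >-> R} := HB.pack F (isMeasurableFun.Build _ _ _ _ F mF).
have n_gt0 : 0 < n%:R :> R by rewrite ltr0n.
have sqn_gt0 : 0 < Num.sqrt n%:R :> R by rewrite sqrtr_gt0.
have Cn_gt0 : 0 < C * n%:R by rewrite mulr_gt0.
pose m := (\int[mu]_x F x)%R.
have mgfX t : ('M_mu X t <= (expR (t * m + C * n%:R * t ^+ 2))%:E)%E.
  rewrite /mmt_gen_fun unlock.
  (* Each of the [n] squared Lipschitz constants is at most [t ^+ 2], whence the variance factor
     [C * n]. *)
  apply: (le_trans (mu_gcb n (fun z => block_dist theta B z * t) n_ge1 _)).
    by move=> i; exists `|t|; exact: lip_const_block_dist.
  rewrite lee_fin -expRD ler_expR RintegralZr// mulrC lerD2l -mulrA.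
  rewrite ler_pM2l// mulr_natl -[X in _ *+ X](card_ord n) -sumr_const.
  by apply: ler_sum => j _; exact: Lip_block_dist_sqr_le.
have m_le : m <= u_B * Num.sqrt n%:R.
  have := sub_gaussian_mean_le Cn_gt0 mgfX mB B_gt0.
  move=> /(_ (block_dist_orbit_eq0 theta01 n B_neq0)) /le_trans; apply.
  rewrite (_ : _ * ln _ = C * ln (fine (mu B)) * n%:R); last by ring.
  (* Splitting off [Num.sqrt n%:R] requires [- (C * ln (mu B)) >= 0], which holds as [mu B <= 1]. *)
  rewrite -mulNr sqrtrM ?mulrA// oppr_ge0 mulr_ge0_le0 ?(ltW C_gt0)// ln_le0//.
  by rewrite -lee_fin fineK ?fin_num_measure// probability_le1.
(* With [r = u * sqrt n] and [V = C * n], the factor [n] cancels in [r ^+ 2 / (4 * V)]. *)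
have := sub_gaussian_tail Cn_gt0 mgfX (mulr_gt0 u_gt0 sqn_gt0).
rewrite exprMn sqr_sqrtr ?(ltW n_gt0)// mulrA -mulf_div divff ?gt_eqF// mulr1.
have mge a : measurable [set x | a <= F x].
  rewrite -[X in measurable X]setTI -preimage_itvcy.
  exact: (mF measurableT _ (measurable_itv _)).
have shadowingE x : ((u_B + u) / Num.sqrt n%:R <= shadowing theta B x n) =
    ((u_B + u) * Num.sqrt n%:R <= F x).
  rewrite shadowing_block_dist -/(F x).
  rewrite -[in n%:R^-1](@sqr_sqrtr _ n%:R) ?(ltW n_gt0)//.
  rewrite ler_pdivrMr// [_ * _ * _](_ : _ = F x / Num.sqrt n%:R) ?ler_pdivlMr//.
  by field; rewrite gt_eqF.
apply: le_trans; under eq_set do rewrite shadowingE.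
(* By [m_le], the threshold [(u_B + u) * sqrt n] is at least [m + u * sqrt n], so the event lies in
   the one already bounded. *)
apply: le_measure; rewrite ?inE// => x /=; apply: le_trans.
by rewrite mulrDl lerD2r.
Qed.
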